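(* Let $n=pq$ be a product of two primes, and let $$\begin{aligned}R_n(X,Y)=\;&16n^{4}X^{4}-128n^{5}X^{3}+(320n^{6}-32n^{8}-32n^{4})X^{2}+(128n^{9}-256n^{7}+128n^{5})X\\&-(16n^{6}+16n^{2}-32n^{4})Y^{2}-64n^{4}X^{2}Y+(384n^{5}+64n^{7}+64n^{3})XY\\&-(192n^{8}+640n^{6}+192n^{4})Y+16n^{12}-64n^{10}+96n^{8}-64n^{6}+16n^{4}.\end{aligned}$$ Put $a=1$, $b=-16n$, $c=2n^4+92n^2+2$, $d=-(16n^5+224n^3+16n)$, and let $e$ satisfy $e^2=n^8+28n^6+198n^4+28n^2+1$. Then the map $$\mathcal I:(X,Y)\longmapsto\left(X,\ \frac{(n^2-1)^2}{n(n^2+1)}\left(Y+\frac{64n^{4}X^{2}-(384n^{5}+64n^{7}+64n^{3})X+(192n^{8}+640n^{6}+192n^{4})}{32(n^3-n)^2}\right)\right)$$ is an isomorphism from the affine plane curve $R_n(X,Y)=0$ over $\mathbb Q$ onto the affine plane curve (Jacobi quartic) over $\mathbb Q$ $$J_Q(X,Z):\quad Z^2=aX^4+bX^3+cX^2+dX+e^2 .$$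
   Context: ''Jacobi quartic'' here simply means an affine plane curve given by an equation of the form $Z^2=aX^4+bX^3+cX^2+dX+e^2$. An isomorphism of affine plane curves over $\mathbb Q$ is a polynomial map with coefficients in $\mathbb Q$ from one to the other having a polynomial inverse with coefficients in $\mathbb Q$. *)

(* Defs.v *)
From HB Require Import structures.
From mathcomp Require Import all_boot all_order all_algebra.
From mathcomp Require Import mpoly.

Set Implicit Arguments.
Unset Strict Implicit.
Unset Printing Implicit Defensive.

Import GRing.Theory.
Local Open Scope ring_scope.

Notation Qpoly2 := {mpoly rat[2]}.

(* The coordinates of the affine plane; the second one plays the role of Y or
   of Z according to the curve. *)
Definition coord1 : Qpoly2 := 'X_ord0.
Definition coord2 : Qpoly2 := 'X_ord_max.

Definition Qeval (A : comAlgType rat) (v : 2.-tuple A) (P : Qpoly2) : A :=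
  mmap (in_alg A) (tnth v) P.

(* An affine plane curve over Q is given by its equation P = 0, and is
   understood through its points with coordinates in all commutative
   Q-algebras A: Q-points alone would not determine the curve. *)
Definition on_curve (P : Qpoly2) (A : comAlgType rat) (v : 2.-tuple A) : Prop :=
  Qeval v P = 0.

Definition polymap := 2.-tuple Qpoly2.

Definition apply_polymap (f : polymap) (A : comAlgType rat) (v : 2.-tuple A) :
  2.-tuple A := map_tuple (Qeval v) f.

Definition maps_curve (f : polymap) (P Q : Qpoly2) : Prop :=
  forall (A : comAlgType rat) (v : 2.-tuple A),
    on_curve P v -> on_curve Q (apply_polymap f v).

Definition left_inverse_on (P : Qpoly2) (f g : polymap) : Prop :=
  forall (A : comAlgType rat) (v : 2.-tuple A),
    on_curve P v -> apply_polymap g (apply_polymap f v) = v.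

Definition curve_isomorphism (f : polymap) (P Q : Qpoly2) : Prop :=
  maps_curve f P Q /\
  exists g : polymap,
    [/\ maps_curve g Q P, left_inverse_on P f g & left_inverse_on Q g f].

Definition Rn (n : rat) : Qpoly2 :=
  let X := coord1 in let Y := coord2 in
  (16 * n ^+ 4) *: X ^+ 4 - (128 * n ^+ 5) *: X ^+ 3
  + (320 * n ^+ 6 - 32 * n ^+ 8 - 32 * n ^+ 4) *: X ^+ 2
  + (128 * n ^+ 9 - 256 * n ^+ 7 + 128 * n ^+ 5) *: X
  - (16 * n ^+ 6 + 16 * n ^+ 2 - 32 * n ^+ 4) *: Y ^+ 2
  - (64 * n ^+ 4) *: (X ^+ 2 * Y)
  + (384 * n ^+ 5 + 64 * n ^+ 7 + 64 * n ^+ 3) *: (X * Y)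
  - (192 * n ^+ 8 + 640 * n ^+ 6 + 192 * n ^+ 4) *: Y
  + (16 * n ^+ 12 - 64 * n ^+ 10 + 96 * n ^+ 8 - 64 * n ^+ 6
     + 16 * n ^+ 4)%:MP.

Definition jacobi_quartic (a b c d e : rat) : Qpoly2 :=
  let X := coord1 in let Z := coord2 in
  Z ^+ 2 - (a *: X ^+ 4 + b *: X ^+ 3 + c *: X ^+ 2 + d *: X + (e ^+ 2)%:MP).

Definition I_map (n : rat) : polymap :=
  let X := coord1 in let Y := coord2 in
  [tuple X;
    ((n ^+ 2 - 1) ^+ 2 / (n * (n ^+ 2 + 1))) *:
      (Y + (32 * (n ^+ 3 - n) ^+ 2)^-1 *:
         ((64 * n ^+ 4) *: X ^+ 2
          - (384 * n ^+ 5 + 64 * n ^+ 7 + 64 * n ^+ 3) *: X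
          + (192 * n ^+ 8 + 640 * n ^+ 6 + 192 * n ^+ 4)%:MP))].

(* Main.v *)
Require Import Defs.
From mathcomp Require Import all_boot all_order all_algebra.
From mathcomp Require Import mpoly.
From mathcomp Require Import ring.

Import Order.TTheory GRing.Theory Num.Theory.
Local Open Scope ring_scope.

(** Write L for the coefficient of -Y in R_n. Completing the square in Y turns
    R_n into a multiple of Z^2 minus a quartic in X, where Z is the second
    coordinate of I. Without denominators: with D = n (n^2 + 1) one has
    D Z = (n^2 - 1)^2 Y + L / (32 n^2), where L / (32 n^2) is polynomial in n,
    and 16 n^2 D^2 J_Q(I(X, Y)) = - (n^2 - 1)^2 R_n(X, Y). Since I is a
    triangular automorphism of the plane, it identifies the two curves. *)

Section Evaluation.
Context {A : comAlgType rat} (v : 2.-tuple A).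

Lemma Qeval_coord1 : Qeval v coord1 = tnth v ord0.
Proof. by rewrite /Qeval /coord1 mmapX mmap1U. Qed.

Lemma Qeval_coord2 : Qeval v coord2 = tnth v ord_max.
Proof. by rewrite /Qeval /coord2 mmapX mmap1U. Qed.

Lemma QevalD P Q : Qeval v (P + Q) = Qeval v P + Qeval v Q.
Proof. exact: mmapD. Qed.

Lemma QevalN P : Qeval v (- P) = - Qeval v P.
Proof. exact: mmapN. Qed.

Lemma QevalM P Q : Qeval v (P * Q) = Qeval v P * Qeval v Q.
Proof. exact: rmorphM. Qed.

Lemma QevalXn P k : Qeval v (P ^+ k) = Qeval v P ^+ k.
Proof. exact: rmorphXn. Qed.

Lemma QevalC k : Qeval v k%:MP = in_alg A k.
Proof. exact: mmapC. Qed.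

Lemma QevalZ k P : Qeval v (k *: P) = in_alg A k * Qeval v P.
Proof. exact: mmapZ. Qed.

Definition QevalE :=
  (QevalD, QevalN, QevalM, QevalXn, QevalC, QevalZ, Qeval_coord1, Qeval_coord2).

End Evaluation.

Lemma tuple2_eq (T : Type) (u v : 2.-tuple T) :
  tnth u ord0 = tnth v ord0 -> tnth u ord_max = tnth v ord_max -> u = v.
Proof.
move=> h0 h1; apply: eq_from_tnth => i.
case: (unliftP ord_max i) => [j ->|-> //].
by rewrite (_ : lift ord_max j = ord0) //; apply: val_inj; rewrite (ord1 j).
Qed.

Section ShearMap.
Variables (s : rat) (h : Qpoly2).

(** [I_map n] is convertible to an instance of this: [s] is its scale factor and [h] the quadratic
    polynomial in X added to Y. *)
Definition shear : polymap := [tuple coord1; s *: (coord2 + h)].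
Definition shear_inv : polymap := [tuple coord1; s^-1 *: coord2 - h].

Lemma shear_fst (A : comAlgType rat) (v : 2.-tuple A) :
  tnth (apply_polymap shear v) ord0 = tnth v ord0.
Proof. by rewrite tnth_map QevalE. Qed.

Lemma shear_snd (A : comAlgType rat) (v : 2.-tuple A) :
  tnth (apply_polymap shear v) ord_max =
  in_alg A s * (tnth v ord_max + Qeval v h).
Proof. by rewrite tnth_map !QevalE. Qed.

Lemma shear_inv_fst (A : comAlgType rat) (v : 2.-tuple A) :
  tnth (apply_polymap shear_inv v) ord0 = tnth v ord0.
Proof. by rewrite tnth_map QevalE. Qed.

Lemma shear_inv_snd (A : comAlgType rat) (v : 2.-tuple A) :
  tnth (apply_polymap shear_inv v) ord_max =
  in_alg A s^-1 * tnth v ord_max - Qeval v h.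
Proof. by rewrite tnth_map !QevalE. Qed.

Hypothesis s_neq0 : s != 0.
(** A semantic way to say that [h] involves X alone. Both maps fix X, so the same value of [h] is
    added by one and subtracted by the other. *)
Hypothesis h_coord1 : forall (A : comAlgType rat) (u v : 2.-tuple A),
  tnth u ord0 = tnth v ord0 -> Qeval u h = Qeval v h.

Lemma shearK (A : comAlgType rat) (v : 2.-tuple A) :
  apply_polymap shear_inv (apply_polymap shear v) = v.
Proof.
apply: tuple2_eq; first by rewrite shear_inv_fst shear_fst.
rewrite shear_inv_snd shear_snd (h_coord1 _ _ _ (shear_fst _ v)).
by rewrite mulrA -rmorphM mulVf // rmorph1 mul1r addrK.
Qed.

Lemma shear_invK (A : comAlgType rat) (v : 2.-tuple A) :
  apply_polymap shear (apply_polymap shear_inv v) = v.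
Proof.
apply: tuple2_eq; first by rewrite shear_fst shear_inv_fst.
rewrite shear_snd shear_inv_snd (h_coord1 _ _ _ (shear_inv_fst _ v)).
by rewrite subrK mulrA -rmorphM mulfV // rmorph1 mul1r.
Qed.

(** The two maps are mutually inverse on the whole plane, so only the equations are left to compare.
    The backward implication, taken at the image under [shear_inv], carries Q back to P. *)
Lemma shear_curve_isomorphism (P Q : Qpoly2) :
  (forall (A : comAlgType rat) (v : 2.-tuple A),
     on_curve P v <-> on_curve Q (apply_polymap shear v)) ->
  curve_isomorphism shear P Q.
Proof.
move=> PQ; split=> [A v /PQ //|]; exists shear_inv; split=> A v Hv.
- by apply/PQ; rewrite shear_invK.
- exact: shearK.
- exact: shear_invK.
Qed.

End ShearMap.

(** [A] may have zero divisors, but a nonzero rational stays invertible in it. *)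
Lemma in_alg_mul_eq0 (A : comAlgType rat) (k : rat) (x : A) :
  k != 0 -> in_alg A k * x = 0 -> x = 0.
Proof.
by move=> k0 kx; rewrite -[x]mul1r -(rmorph1 (in_alg A)) -(mulVf k0) rmorphM
  -mulrA kx mulr0.
Qed.

(** Denominators are cleared because [A] need not be a field: [E1] and [E2] cancel them in [rat],
    and the rest is a ring identity in [A]. *)
Lemma I_map_curve (n a b c d e : rat) (A : comAlgType rat) (v : 2.-tuple A) :
  n != 0 -> n ^+ 2 != 1 ->
  a = 1 -> b = - (16 * n) -> c = 2 * n ^+ 4 + 92 * n ^+ 2 + 2 ->
  d = - (16 * n ^+ 5 + 224 * n ^+ 3 + 16 * n) ->
  e ^+ 2 = n ^+ 8 + 28 * n ^+ 6 + 198 * n ^+ 4 + 28 * n ^+ 2 + 1 ->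
  in_alg A (16 * n ^+ 2 * (n * (n ^+ 2 + 1)) ^+ 2) *
    Qeval (apply_polymap (I_map n) v) (jacobi_quartic a b c d e) =
  in_alg A (- (n ^+ 2 - 1) ^+ 2) * Qeval v (Rn n).
Proof.
move=> n0 n1 -> -> -> -> he.
have D0 : n ^+ 2 + 1 != 0 by rewrite gt_eqF // ltr_wpDl ?sqr_ge0.
have m0 : n ^+ 2 - 1 != 0 by rewrite subr_eq0.
rewrite /jacobi_quartic /Rn !QevalE he shear_fst shear_snd !QevalE.
set x := tnth v ord0; set y := tnth v ord_max.
set Z := _ * (y + _); set N := in_alg A n.
have DZ : in_alg A (n * (n ^+ 2 + 1)) * Z =
    (N ^+ 2 - 1) ^+ 2 * y + 2 * N ^+ 2 * x ^+ 2
    - (12 * N ^+ 3 + 2 * N ^+ 5 + 2 * N) * x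
    + (6 * N ^+ 6 + 20 * N ^+ 4 + 6 * N ^+ 2).
  have E1 : n * (n ^+ 2 + 1) * ((n ^+ 2 - 1) ^+ 2 / (n * (n ^+ 2 + 1))) =
      (n ^+ 2 - 1) ^+ 2 by field; rewrite n0 D0.
  (* Since n^3 - n = n (n^2 - 1), the scale factor leaves only 32 n^2 in the denominator. *)
  have E2 : (n ^+ 2 - 1) ^+ 2 * (32 * (n ^+ 3 - n) ^+ 2)^-1 * (32 * n ^+ 2) = 1.
    field.
    by rewrite (_ : n ^+ 3 - n = n * (n ^+ 2 - 1)) ?mulf_neq0 //; ring.
  (* This is L / (32 n^2), with the division carried out on each coefficient. *)
  pose M := 2 * N ^+ 2 * x ^+ 2 - (12 * N ^+ 3 + 2 * N ^+ 5 + 2 * N) * x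
    + (6 * N ^+ 6 + 20 * N ^+ 4 + 6 * N ^+ 2).
  rewrite /Z; set l := (X in y + _ * X).
  have -> : l = in_alg A (32 * n ^+ 2) * M by rewrite /l /M /N; ring.
  transitivity (in_alg A ((n ^+ 2 - 1) ^+ 2) * y + M); last first.
    by rewrite /M /N; ring.
  rewrite mulrA -(rmorphM (in_alg A)) E1 mulrDr 2!mulrA.
  by rewrite -!(rmorphM (in_alg A)) E2 rmorph1 mul1r.
(* D^2 is split off so that it merges with Z^2 into (D Z)^2, to which [DZ] applies. *)
have -> : in_alg A (16 * n ^+ 2 * (n * (n ^+ 2 + 1)) ^+ 2) =
    16 * N ^+ 2 * in_alg A (n * (n ^+ 2 + 1)) ^+ 2 by rewrite /N; ring.
rewrite -[LHS]mulrA mulrBr -exprMn DZ /N.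
by ring.
Qed.

Theorem theorem2p16 (p q : nat) (hp : prime p) (hq : prime q)
    (n : rat) (hn : n = (p * q)%N%:R)
    (a b c d e : rat)
    (ha : a = 1)
    (hb : b = - (16 * n))
    (hc : c = 2 * n ^+ 4 + 92 * n ^+ 2 + 2)
    (hd : d = - (16 * n ^+ 5 + 224 * n ^+ 3 + 16 * n))
    (he : e ^+ 2 = n ^+ 8 + 28 * n ^+ 6 + 198 * n ^+ 4 + 28 * n ^+ 2 + 1) :
  curve_isomorphism (I_map n) (Rn n) (jacobi_quartic a b c d e).
Proof.
(* n > 1 makes n and n^2 - 1 nonzero, hence the scale factor of I well defined and invertible. *)
have n_gt1 : 1 < n.
  by rewrite hn ltr1n (leq_trans (prime_gt1 hp)) // leq_pmulr // prime_gt0.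
have n0 : n != 0 by rewrite gt_eqF // (lt_trans ltr01).
have n1 : n ^+ 2 != 1 by rewrite gt_eqF // exprn_egt1.
have D0 : n * (n ^+ 2 + 1) != 0.
  by rewrite mulf_neq0 // gt_eqF // ltr_wpDl ?sqr_ge0.
have m0 : n ^+ 2 - 1 != 0 by rewrite subr_eq0.
apply: shear_curve_isomorphism => [|A u v uv|A v].
- by rewrite mulf_neq0 ?invr_eq0 // expf_neq0.
- by rewrite !QevalE uv.
(* The constants on both sides of [E] are nonzero, so either equation forces the other. *)
have E := I_map_curve _ _ _ _ _ _ _ v n0 n1 ha hb hc hd he.
rewrite /on_curve; split=> H.
- apply: in_alg_mul_eq0 (etrans E _); last by rewrite H mulr0.
  by apply: mulf_neq0; [apply: mulf_neq0 => //|]; apply: expf_neq0.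
- apply: in_alg_mul_eq0 (etrans (esym E) _); last by rewrite H mulr0.
  by rewrite oppr_eq0 expf_neq0.
Qed.
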